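(* Let $R$ be a ring and let $\varphi\colon G\to Q$ be an epimorphism onto a nilpotent group $Q$, where $G$ is a group of type $\mathrm{FTP}_d(R)$. If there is a multicharacter $\chi=(\chi_i)_{i=0}^{n-1}$ on $Q$ such that $$H^d\big(G;\widehat{RG}^{(\pm\chi_0,\dots,\pm\chi_{n-1})}\big)=0$$ for all $2^n$ choices of signs, then $\mathrm{cd}_R(\ker\varphi)<d$.
   Context: Rings are nonzero, associative and unital. $\mathrm{cd}_R(G)=\sup\{n : H^n(G;M)\neq 0 \text{ for some } RG\text{-module } M\}$. A group $G$ is of type $\mathrm{FTP}_d(R)$ if the trivial $RG$-module $R$ admits a projective resolution $0\to P_d\to\cdots\to P_0\to R\to0$ with $P_d$ finitely generated. Crossed products and Novikov rings. For a ring $R$ and a group $\Gamma$, a crossed product $R*\Gamma$ is a $\Gamma$-graded ring $\bigoplus_\gamma R_\gamma$ with $R_e=R$ such that each $R_\gamma$ contains a unit $u_\gamma$; elements are uniquely finite sums $\sum r_\gamma u_\gamma$, $r_\gamma\in R$. For a homomorphism $\chi\colon\Gamma\to\mathbb{R}$, $\widehat{R*\Gamma}^\chi$ is the ring of formal series $\sum_{\gamma\in\Gamma}r_\gamma u_\gamma$ such that $\{\gamma: r_\gamma\neq0,\chi(\gamma)\leqslant t\}$ is finite for all $t\in\mathbb{R}$, with multiplication extending that of $R*\Gamma$. A central series of a nilpotent group $Q$ is a series $1=Q_n\leqslant\cdots\leqslant Q_0=Q$ of normal subgroups with $Q_i/Q_{i+1}\leqslant Z(Q/Q_{i+1})$;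 a multicharacter on $Q$ is a list $\chi=(\chi_i\colon Q_i/Q_{i+1}\to\mathbb{R})_{i=0}^{n-1}$ of homomorphisms for some central series. Given a crossed product $S*Q$, define recursively rings $S_n=S,\dots,S_0$ and crossed products $S_i*(Q/Q_i)$ containing $S*Q$ by $S_i=\widehat{S_{i+1}*(Q_i/Q_{i+1})}^{\chi_i}$; because $Q_i/Q_{i+1}$ is central in $Q/Q_{i+1}$, the multiplication of $S_{i+1}*(Q/Q_{i+1})$ extends to a crossed product $S_i*(Q/Q_i)$. Put $\widehat{S*Q}^\chi:=S_0$. For an epimorphism $G\to Q$ with kernel $N$, $RG=(RN)*Q$ (with $u_q=s(q)$ for a set-theoretic section $s\colon Q\to G$) and $\widehat{RG}^\chi:=\widehat{(RN)*Q}^\chi$, a ring containing $RG$. *)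

(* Defs.v *)
From HB Require Import structures.
From mathcomp Require Import all_boot all_order all_algebra.
From mathcomp Require Import boolp classical_sets functions cardinality fsbigop.
From mathcomp Require Import reals ereal.

Set Implicit Arguments.
Unset Strict Implicit.
Unset Printing Implicit Defensive.

Import Order.TTheory GRing.Theory Num.Theory.

Local Open Scope classical_set_scope.
Local Open Scope ring_scope.

Section FiniteSums.
Context {T : choiceType} {C : nzRingType}.
Implicit Types (f : T -> C) (A : set T).

Definition supp f : set T := [set x | f x != 0].

Lemma finite_uniq_seq A : finite_set A -> exists2 s : seq T, uniq s & A = [set` s].
Proof.
move=> /finite_seqP[s ->]; exists (undup s); first exact: undup_uniq.
by apply/seteqP; split=> x /=; rewrite mem_undup.
Qed.

Lemma fsum_seq f (s : seq T) : uniq s -> supp f `<=` [set` s] ->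
  \sum_(x \in [set: T]) f x = \sum_(x <- s) f x.
Proof.
move=> us fs; rewrite (fsbigE s) //.
  by apply: eq_bigl => x; rewrite in_setT.
by move=> x _ xs; apply/eqP; apply: contraNT xs => fx0; exact: (fs _ fx0).
Qed.

Lemma fsumD f g : finite_set (supp f) -> finite_set (supp g) ->
  \sum_(x \in [set: T]) (f x + g x) =
  \sum_(x \in [set: T]) f x + \sum_(x \in [set: T]) g x.
Proof.
move=> ff fg; have fU : finite_set (supp f `|` supp g) by rewrite finite_setU.
have [s us sE] := finite_uniq_seq fU.
have sf : supp f `<=` [set` s] by rewrite -sE => x; left.
have sg : supp g `<=` [set` s] by rewrite -sE => x; right.
rewrite (fsum_seq us sf) (fsum_seq us sg) -big_split (fsum_seq us) // -sE => x.
rewrite /supp /=; have [->|] := eqVneq (f x) 0; last by left.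
by rewrite add0r; right.
Qed.

Lemma fsum_ind (P : C -> Prop) f : P 0 -> (forall a b, P a -> P b -> P (a + b)) ->
  (forall x, P (f x)) -> P (\sum_(x \in [set: T]) f x).
Proof. by move=> P0 PD Pf; elim/big_ind: _ => // *; exact: PD. Qed.

Lemma fsum1 f x0 : (forall x, x != x0 -> f x = 0) ->
  \sum_(x \in [set: T]) f x = f x0.
Proof.
move=> f0; rewrite (@fsum_seq f [:: x0]) ?big_seq1 // => x /= fx.
by rewrite inE; apply: contraNT fx => /f0 ->.
Qed.

End FiniteSums.

Section Convolution.
Context {T : groupType} {C : nzRingType}.

Definition convolution (f g : T -> C) (x : T) : C :=
  \sum_(y \in [set: T]) f y * g (y^-1 * x)%g.

Definition set_mulg (A B : set T) : set T :=
  [set z | exists a b, [/\ A a, B b & z = (a * b)%g]].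

End Convolution.

(* A family of subsets of T closed enough for the functions T -> C with support
   in the family to form a ring under convolution. *)
Record support_family (T : groupType) := SupportFamily {
  is_support :> set T -> Prop;
  support_sub : forall A B, A `<=` B -> is_support B -> is_support A;
  supportU : forall A B, is_support A -> is_support B -> is_support (A `|` B);
  support1 : is_support [set 1%g];
  supportM : forall A B,
    is_support A -> is_support B -> is_support (set_mulg A B);
  support_finite : forall A B x, is_support A -> is_support B ->
    finite_set [set a | A a /\ B (a^-1 * x)%g] }.

(* The subgroup of C allowed for the coefficients of degree x. *)
Record coefficients (T : groupType) (C : nzRingType) := Coefficients {
  allowed :> T -> set C;
  allowed0 : forall x, allowed x 0;
  allowedB : forall x a b, allowed x a -> allowed x b -> allowed x (a - b);
  allowed1 : allowed 1%g 1;
  allowedM : forall x y a b,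
    allowed x a -> allowed y b -> allowed (x * y)%g (a * b) }.

Section Series.
Context {T : groupType} {C : nzRingType}.
Variables (S : support_family T) (A : coefficients T C).

Definition is_series : {pred T -> C} :=
  fun f => `[< S (supp f) /\ forall x, A x (f x) >].

Record series := Series { coef :> T -> C; _ : is_series coef }.

HB.instance Definition _ := [isSub for coef].
HB.instance Definition _ := [Choice of series by <:].

Lemma seriesP (f : series) : S (supp f) /\ forall x, A x (f x).
Proof. by case: f => f /= /asboolP. Qed.

Lemma allowedD x a b : A x a -> A x b -> A x (a + b).
Proof.
move=> Aa Ab; rewrite -[b]opprK; apply: allowedB => //.
by rewrite -sub0r; apply: allowedB => //; exact: allowed0.
Qed.

Lemma is_series_zmod : zmod_closed is_series.
Proof.
split=> [|f g /asboolP[Sf Af] /asboolP[Sg Ag]]; apply/asboolP.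
  split=> [|x]; last exact: allowed0.
  by apply: support_sub (support1 S) => x; rewrite /supp /= eqxx.
split=> [|x]; last exact: allowedB.
apply: support_sub (supportU Sf Sg) => x; rewrite /supp /=.
rewrite -[(f - g) x]/(f x - g x).
by have [->|] := eqVneq (f x) 0; [rewrite sub0r oppr_eq0; right | left].
Qed.

HB.instance Definition _ := GRing.isZmodClosed.Build _ is_series is_series_zmod.
HB.instance Definition _ := [SubChoice_isSubZmodule of series by <:].

Lemma supp_convolution (f g : T -> C) :
  supp (convolution f g) `<=` set_mulg (supp f) (supp g).
Proof.
move=> x; rewrite /supp /=; apply: contraNP => H; apply/eqP/fsbig1 => y _.
have [->|fy] := eqVneq (f y) 0; first by rewrite mul0r.
have [->|gy] := eqVneq (g (y^-1 * x)%g) 0; first by rewrite mulr0.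
by case: H; exists y, (y^-1 * x)%g; rewrite mulVKg.
Qed.

Lemma supp_term (f g : T -> C) x :
  supp (fun y => f y * g (y^-1 * x)%g) `<=`
  [set y | supp f y /\ supp g (y^-1 * x)%g].
Proof.
move=> y; rewrite /supp /=; have [->|fy] := eqVneq (f y) 0.
  by rewrite mul0r eqxx.
by have [->|gy] := eqVneq (g _) 0; first by rewrite mulr0 eqxx.
Qed.

Lemma finite_term (f g : series) x :
  finite_set (supp (fun y => f y * g (y^-1 * x)%g)).
Proof.
apply: (sub_finite_set (@supp_term f g x)).
exact: support_finite (proj1 (seriesP f)) (proj1 (seriesP g)).
Qed.

Lemma is_series_convolution (f g : series) : is_series (convolution f g).
Proof.
have [[Sf Af] [Sg Ag]] := (seriesP f, seriesP g); apply/asboolP; split.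
  by apply: support_sub (supportM Sf Sg); exact: supp_convolution.
move=> x; rewrite /convolution; apply: fsum_ind => [|a b|y]; first exact: allowed0.
  exact: allowedD.
by rewrite -{1}[x](mulVKg y); exact: allowedM.
Qed.

Lemma is_series_one : is_series (fun x => if x == 1%g then 1 else 0).
Proof.
apply/asboolP; split=> [|x].
  apply: support_sub (support1 S) => x; rewrite /supp /=.
  by have [//|_ /=] := eqVneq x 1%g; rewrite eqxx.
by case: eqP => [->|_]; [exact: allowed1 | exact: allowed0].
Qed.

Definition series_one : series := Series is_series_one.
Definition series_mul (f g : series) : series :=
  Series (is_series_convolution f g).

Lemma seriesE (f g : series) : (forall x, f x = g x) -> f = g.
Proof. by move=> fg; apply/val_inj/funext. Qed.

Lemma series_mulE f g x : series_mul f g x = \sum_(y \in [set: T]) f y * g (y^-1 * x)%g.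
Proof. by []. Qed.

Lemma coefD (f g : series) x : (f + g) x = f x + g x. Proof. by []. Qed.

Lemma coefB (f g : series) x : (f - g) x = f x - g x. Proof. by []. Qed.

Lemma series_mul1 : left_id series_one series_mul.
Proof.
move=> f; apply: seriesE => x; rewrite series_mulE (@fsum1 _ _ _ 1%g) /=.
  by rewrite eqxx mul1r invg1 mul1g.
by move=> y /negPf ->; rewrite mul0r.
Qed.

Lemma series_1mul : right_id series_one series_mul.
Proof.
move=> f; apply: seriesE => x; rewrite series_mulE (@fsum1 _ _ _ x) /=.
  by rewrite mulVg eqxx mulr1.
move=> y yx; case: eqP; rewrite ?mulr0 // => /(congr1 (fun z => y * z)%g).
by rewrite mulVKg mulg1 => xy; rewrite xy eqxx in yx.
Qed.

Lemma series_mulDl : left_distributive series_mul +%R.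
Proof.
move=> f g h; apply: seriesE => x; rewrite coefD !series_mulE -fsumD.
- by apply: eq_fsbigr => y _; rewrite coefD mulrDl.
- exact: finite_term.
- exact: finite_term.
Qed.

Lemma series_mulDr : right_distributive series_mul +%R.
Proof.
move=> f g h; apply: seriesE => x; rewrite coefD !series_mulE -fsumD.
- by apply: eq_fsbigr => y _; rewrite coefD mulrDr.
- exact: finite_term.
- exact: finite_term.
Qed.

Lemma series_mulA : associative series_mul.
Proof.
move=> f g h; apply: seriesE => x; apply/esym.
have [[Sf _] [Sg _] [Sh _]] := And3 (seriesP f) (seriesP g) (seriesP h).
have [Z uZ ZE] := finite_uniq_seq (support_finite x (supportM Sf Sg) Sh).
have [Y uY YE] := finite_uniq_seq (support_finite x Sf (supportM Sg Sh)).
have inZ y z : f y != 0 -> g (y^-1 * z)%g != 0 -> h (z^-1 * x)%g != 0 -> z \in Z.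
  move=> fy gy hz; suff : [set` Z] z by [].
  by rewrite -ZE; split=> //; exists y, (y^-1 * z)%g; rewrite mulVKg.
have inY y z : f y != 0 -> g (y^-1 * z)%g != 0 -> h (z^-1 * x)%g != 0 -> y \in Y.
  move=> fy gy hz; suff : [set` Y] y by [].
  rewrite -YE; split=> //; exists (y^-1 * z)%g, (z^-1 * x)%g; split=> //.
  by rewrite -mulgA mulVKg.
transitivity (\sum_(z <- Z) \sum_(y <- Y) f y * g (y^-1 * z)%g * h (z^-1 * x)%g).
  rewrite series_mulE (fsum_seq uZ); last first.
    move=> z /=; rewrite /supp /= => fgh.
    have [h0|hz] := eqVneq (h (z^-1 * x)%g) 0; first by rewrite h0 mulr0 eqxx in fgh.
    have : convolution f g z != 0.
      by apply: contraNneq fgh => fg0; rewrite fg0 mul0r.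
    by move=> /supp_convolution[a [b [fa gb zE]]]; apply: (inZ a); rewrite // zE mulKg.
  apply: eq_bigr => z _; rewrite -mulr_suml.
  have [->|hz] := eqVneq (h (z^-1 * x)%g) 0; first by rewrite !mulr0.
  congr (_ * _); apply: fsum_seq => // y /supp_term[fy gy]; exact: (inY y z).
rewrite exchange_big series_mulE (fsum_seq uY); last first.
  move=> y /supp_term[fy /supp_convolution[a [b [ga hb yE]]]].
  apply: (inY y (y * a)%g); rewrite // ?mulKg //.
  by rewrite invgM -mulgA yE mulKg.
apply: eq_bigr => y _; under eq_bigr do rewrite -mulrA.
rewrite -mulr_sumr.
have [->|fy] := eqVneq (f y) 0; first by rewrite !mul0r.
congr (_ * _); rewrite series_mulE (reindex_fsbigT (fun z => y^-1 * z)%g); last first.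
  by exists (fun z => y * z)%g; [exact: mulVKg | exact: mulKg].
rewrite (fsum_seq uZ).
  by apply: eq_bigr => z _; rewrite invgM invgK -mulgA mulVKg.
move=> z; rewrite /supp /= invgM invgK -mulgA mulVKg => gh.
by apply: (inZ y) => //; apply: contraNneq gh => ->; rewrite ?mul0r ?mulr0.
Qed.

Lemma series_one_neq0 : series_one != 0.
Proof.
apply/eqP => /(congr1 (fun f : series => f 1%g)) /=.
by rewrite eqxx => /eqP; rewrite oner_eq0.
Qed.

HB.instance Definition _ := GRing.Zmodule_isNzRing.Build series
  series_mulA series_mul1 series_1mul series_mulDl series_mulDr series_one_neq0.

End Series.

Section GroupRing.
Context {R : nzRingType} {G : groupType}.

Lemma finite_support_sub (A B : set G) :
  A `<=` B -> finite_set B -> finite_set A.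
Proof. exact: sub_finite_set. Qed.

Lemma finite_supportU (A B : set G) :
  finite_set A -> finite_set B -> finite_set (A `|` B).
Proof. by move=> fA fB; rewrite finite_setU. Qed.

Lemma finite_supportM (A B : set G) :
  finite_set A -> finite_set B -> finite_set (set_mulg A B).
Proof.
move=> fA fB; apply: (sub_finite_set _ (finite_image
  (fun p : G * G => (p.1 * p.2)%g) (finite_setX fA fB))).
by move=> z [a [b [Aa Bb ->]]]; exists (a, b).
Qed.

Lemma finite_support_finite (A B : set G) x : finite_set A -> finite_set B ->
  finite_set [set a | A a /\ B (a^-1 * x)%g].
Proof. by move=> fA _; apply: sub_finite_set fA => a []. Qed.

Definition finite_supports : support_family G :=
  SupportFamily finite_support_sub finite_supportU (finite_set1 1%g)
    finite_supportM finite_support_finite.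

Definition all_coefficients : coefficients G R :=
  @Coefficients G R (fun _ => setT) (fun _ => I) (fun _ _ _ _ _ => I) I
    (fun _ _ _ _ _ _ => I).

End GroupRing.

Definition group_ring (R : nzRingType) (G : groupType) : nzRingType :=
  series (@finite_supports G) (@all_coefficients R G).

Section Augmentation.
Context {R : nzRingType} {G : groupType}.
Implicit Types a b : group_ring R G.

Lemma group_ring_finite a : finite_set (supp (coef a)).
Proof. by have [] := seriesP a. Qed.

Definition augmentation a : R := \sum_(g \in [set: G]) coef a g.

Lemma augmentation_nmod : nmod_morphism augmentation.
Proof.
split=> [|a b]; first by apply: fsbig1.
by rewrite /augmentation -fsumD //; exact: group_ring_finite.
Qed.

Lemma augmentation_monoid : monoid_morphism augmentation.
Proof.
split=> [|a b]; first by rewrite /augmentation (@fsum1 _ _ _ 1%g) /= ?eqxx // => x /negPf ->.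
have fa := group_ring_finite a; have fb := group_ring_finite b.
have [X uX XE] := finite_uniq_seq (finite_supportM fa fb).
have [Y uY YE] := finite_uniq_seq fa.
rewrite /augmentation (fsum_seq uX); last by rewrite -XE; exact: supp_convolution.
rewrite (fsum_seq uY (f := coef a)) -?YE // mulr_suml.
transitivity (\sum_(x <- X) \sum_(y <- Y) coef a y * coef b (y^-1 * x)%g).
  apply: eq_bigr => x _; apply: fsum_seq => // y /supp_term[ay _].
  by rewrite -YE.
rewrite exchange_big big_seq [RHS]big_seq; apply: eq_bigr => y yY.
rewrite -mulr_sumr; congr (_ * _).
rewrite (reindex_fsbigT (fun z => y^-1 * z)%g); last first.
  by exists (fun z => y * z)%g; [exact: mulVKg | exact: mulKg].
apply/esym/fsum_seq => // x bx; rewrite -XE.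
by exists y, (y^-1 * x)%g; split; rewrite ?mulVKg // YE.
Qed.

HB.instance Definition _ :=
  GRing.isNmodMorphism.Build _ _ augmentation augmentation_nmod.
HB.instance Definition _ :=
  GRing.isMonoidMorphism.Build _ _ augmentation augmentation_monoid.

End Augmentation.

Section RestrictScalars.
Context {A B : nzRingType}.

Definition restrict_scalars (f : {rmorphism A -> B}) (M : lmodType B) : Type := M.

Variables (f : {rmorphism A -> B}) (M : lmodType B).
Local Notation fM := (restrict_scalars f M).

HB.instance Definition _ := GRing.Zmodule.on fM.

Definition restrict_scale (a : A) (x : fM) : fM := f a *: (x : M).

Lemma restrict_scaleA a b v :
  restrict_scale a (restrict_scale b v) = restrict_scale (a * b) v.
Proof. by rewrite /restrict_scale scalerA rmorphM. Qed.

Lemma restrict_scale1 : left_id 1 restrict_scale.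
Proof. by move=> v; rewrite /restrict_scale rmorph1 scale1r. Qed.

Lemma restrict_scaleDr : right_distributive restrict_scale +%R.
Proof. by move=> a u v; rewrite /restrict_scale scalerDr. Qed.

Lemma restrict_scaleDl v : {morph restrict_scale^~ v : a b / a + b}.
Proof. by move=> a b; rewrite /restrict_scale rmorphD scalerDl. Qed.

HB.instance Definition _ := GRing.Zmodule_isLmodule.Build A fM
  restrict_scaleA restrict_scale1 restrict_scaleDr restrict_scaleDl.

End RestrictScalars.

Definition trivial_module (R : nzRingType) (G : groupType) :
    lmodType (group_ring R G) :=
  restrict_scalars (@augmentation R G) R^o.

Section Ext.
Context {A : nzRingType}.

Definition projective (P : lmodType A) : Prop :=
  forall (U V : lmodType A) (p : {linear U -> V}) (f : {linear P -> V}),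
    (forall v, exists u, p u = v) ->
    exists g : {linear P -> U}, forall x, p (g x) = f x.

Definition finitely_generated (M : lmodType A) : Prop :=
  exists s : seq M, forall x, exists c : 'I_(size s) -> A,
    x = \sum_(i < size s) c i *: s`_i.

Record projective_resolution (B : lmodType A) := ProjectiveResolution {
  res : nat -> lmodType A;
  res_d : forall i, {linear res i.+1 -> res i};
  res_aug : {linear res 0 -> B};
  res_projective : forall i, projective (res i);
  res_aug_surj : forall b, exists x, res_aug x = b;
  res_exact0 : forall x, res_aug x = 0 <-> exists y, res_d 0 y = x;
  res_exact : forall i x, res_d i x = 0 <-> exists y, res_d i.+1 y = x }.

Section Cochains.
Context {B : lmodType A} (P : projective_resolution B) (M : lmodType A).

Definition cocycle n (f : {linear res P n -> M}) : Prop :=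
  forall y, f (res_d P n y) = 0.

Definition coboundary n : {linear res P n -> M} -> Prop :=
  match n with
  | 0 => fun f => forall x, f x = 0
  | k.+1 => fun f => exists g : {linear res P k -> M},
      forall x, f x = g (res_d P k x)
  end.

End Cochains.

(* Ext^n_A(B, M) = 0. Ext does not depend on the resolution used to compute it,
   and every module has one. *)
Definition Ext_eq0 (n : nat) (B M : lmodType A) : Prop :=
  forall (P : projective_resolution B) (f : {linear res P n -> M}),
    cocycle f -> coboundary f.

End Ext.

(* H^n(G; M) = Ext^n_{RG}(R, M) *)
Definition cohomology_eq0 (R : nzRingType) (G : groupType) (n : nat)
    (M : lmodType (group_ring R G)) : Prop :=
  Ext_eq0 n (trivial_module R G) M.

Definition cd (K : realType) (R : nzRingType) (G : groupType) : \bar K :=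
  ereal_sup [set n%:R%:E | n in
    [set n | exists M : lmodType (group_ring R G), ~ cohomology_eq0 n M]].

Definition type_FTP (d : nat) (R : nzRingType) (G : groupType) : Prop :=
  exists P : projective_resolution (trivial_module R G),
    (forall i, (d < i)%N -> forall x : res P i, x = 0) /\
    finitely_generated (res P d).

Section Kernel.
Context {G Q : groupType}.
Variable phi : {multiplicative G -> Q}.

Lemma mult1 : phi 1%g = 1%g.
Proof. by apply: (mulgI (phi 1%g)); rewrite -gmulfM !mulg1. Qed.

Lemma multV x : phi x^-1%g = (phi x)^-1%g.
Proof. by apply: (mulgI (phi x)); rewrite -gmulfM !mulgV mult1. Qed.

Definition in_kernel : {pred G} := fun g => phi g == 1%g.

Record kernel := Kernel { kernel_val : G; _ : in_kernel kernel_val }.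

HB.instance Definition _ := [isSub for kernel_val].
HB.instance Definition _ := [Choice of kernel by <:].

Lemma in_kernel_group : group_closed in_kernel.
Proof.
split=> [|x y /eqP px /eqP py]; apply/eqP; first exact: mult1.
by rewrite gmulfM multV px py divg1.
Qed.

HB.instance Definition _ :=
  SubChoice_isSubGroup.Build G in_kernel kernel in_kernel_group.

End Kernel.

(* A ring C = S * Q: component q is the projection of C onto its summand of
   degree q, which is thus {c | component q c = c}; S is the summand of
   degree 1. *)
Record crossed_product (Q : groupType) (C : nzRingType) := CrossedProduct {
  component : Q -> C -> C;
  componentB : forall q, {morph component q : a b / a - b};
  componentK : forall p q c,
    component p (component q c) = if p == q then component q c else 0;
  component_finite : forall c, finite_set [set q | component q c != 0];
  component_sum : forall c, \sum_(q \in [set: Q]) component q c = c;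
  component1 : component 1%g 1 = 1;
  componentM : forall p q a b, component p a = a -> component q b = b ->
    component (p * q)%g (a * b) = a * b;
  component_unit : forall q, exists u v,
    [/\ component q u = u, u * v = 1 & v * u = 1] }.

Section CrossedProductTheory.
Context {Q : groupType} {C : nzRingType}.
Variable X : crossed_product Q C.

Lemma component0 q : component X q 0 = 0.
Proof. by rewrite -[0 in LHS](subrr 0) componentB subrr. Qed.

Lemma componentD q : {morph component X q : a b / a + b}.
Proof.
move=> a b; rewrite -[b in LHS]opprK -[- b]sub0r componentB componentB.
by rewrite component0 sub0r opprK.
Qed.

Lemma component_bigsum q I (r : seq I) (P : pred I) (F : I -> C) :
  component X q (\sum_(i <- r | P i) F i) = \sum_(i <- r | P i) component X q (F i).
Proof. exact: (big_morph _ (componentD q) (component0 q)). Qed.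

Definition homogeneous (q : Q) : set C := [set c | component X q c = c].

Lemma homogeneousB q a b :
  homogeneous q a -> homogeneous q b -> homogeneous q (a - b).
Proof. by rewrite /homogeneous /= => qa qb; rewrite componentB qa qb. Qed.

Definition homogeneous_coefficients : coefficients Q C :=
  Coefficients component0 homogeneousB (component1 X) (@componentM _ _ X).

Lemma component_homogeneous q c : homogeneous q (component X q c).
Proof. by rewrite /homogeneous /= componentK eqxx. Qed.

Lemma component_mul q a b : component X q (a * b) =
  \sum_(p \in [set: Q]) component X p a * component X (p^-1 * q)%g b.
Proof.
have [Y uY YE] := finite_uniq_seq (component_finite X a).
have [W uW WE] := finite_uniq_seq (component_finite X b).
rewrite -[a in LHS](component_sum X) -[b in LHS](component_sum X).
rewrite (fsum_seq uY) -?YE // (fsum_seq uW) -?WE //.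
rewrite mulr_suml component_bigsum (fsum_seq uY); last first.
  rewrite -YE => p; rewrite /supp /=; apply: contraNneq => ->.
  by rewrite mul0r.
apply: eq_bigr => p _; rewrite mulr_sumr component_bigsum.
transitivity (\sum_(w <- W) (if w == (p^-1 * q)%g
    then component X p a * component X w b else 0)).
  apply: eq_bigr => w _.
  have pwE := componentM (component_homogeneous p a) (component_homogeneous w b).
  rewrite -pwE componentK pwE.
  by rewrite eq_sym (can2_eq (mulKg p) (mulVKg p)).
rewrite -big_mkcond /=.
have [wW|wW] := boolP ((p^-1 * q)%g \in W).
  by rewrite (big_rem _ wW) /= eqxx big1_seq ?addr0 // => w /andP[/eqP->];
     rewrite mem_rem_uniqF.
rewrite big1_seq => [|w /andP[/eqP->]]; last by rewrite (negPf wW).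
have /eqP-> : component X (p^-1 * q)%g b == 0; last by rewrite mulr0.
apply: contraNT wW => bw; suff : [set` W] (p^-1 * q)%g by [].
by rewrite -WE.
Qed.

End CrossedProductTheory.

(* The crossed product structure RG = (R ker phi) * Q: the summand of degree q
   consists of the elements supported on the fibre of phi over q. *)
Section GroupRingCrossedProduct.
Context {R : nzRingType} {G Q : groupType}.
Variable phi : {multiplicative G -> Q}.
Context (phi_surj : forall q, exists g, phi g = q).
Implicit Types a b : group_ring R G.

Definition fibre_fun q a : G -> R := fun g => if phi g == q then coef a g else 0.

Lemma fibre_fun_series q a : is_series finite_supports all_coefficients (fibre_fun q a).
Proof.
apply/asboolP; split=> //; apply: sub_finite_set (group_ring_finite a) => g.
by rewrite /supp /= /fibre_fun; case: ifP => //; rewrite eqxx.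
Qed.

Definition fibre_component q a : group_ring R G := Series (fibre_fun_series q a).

Lemma coef_sum I (r : seq I) (F : I -> group_ring R G) g :
  coef (\sum_(i <- r) F i) g = \sum_(i <- r) coef (F i) g.
Proof. by elim/big_rec2: _ => // i x y _ <-. Qed.

Lemma fibre_componentB q : {morph fibre_component q : a b / a - b}.
Proof.
move=> a b; apply: seriesE => g; rewrite coefB /= /fibre_fun.
by case: ifP => _; rewrite ?subr0.
Qed.

Lemma fibre_componentK p q a : fibre_component p (fibre_component q a) =
  if p == q then fibre_component q a else 0.
Proof.
apply: seriesE => g; rewrite /= /fibre_fun.
have [->|pq] := eqVneq p q; rewrite /= /fibre_fun; first by case: (phi g == q).
by case: eqP => // gp; case: eqP => // gq; rewrite -gp -gq eqxx in pq.
Qed.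

Lemma fibre_component_finite a : finite_set [set q | fibre_component q a != 0].
Proof.
apply: sub_finite_set (finite_image phi (group_ring_finite a)) => q /= qa.
apply: contrapT => H; case/negP: qa; apply/eqP/seriesE => g /=.
rewrite /fibre_fun; case: eqP => // gq.
by apply/eqP; apply/negPn/negP => ag; case: H; exists g.
Qed.

Lemma fibre_component_sum a : \sum_(q \in [set: Q]) fibre_component q a = a.
Proof.
have [s us sE] := finite_uniq_seq (fibre_component_finite a).
rewrite (fsum_seq us) -?sE //; apply: seriesE => g; rewrite coef_sum /= /fibre_fun.
have [gs|gs] := boolP (phi g \in s).
  rewrite (big_rem _ gs) /= eqxx big1_seq ?addr0 // => q /andP[_ qs].
  case: eqP => // gq; move: qs; rewrite -gq mem_rem_uniqF //.
rewrite big1_seq => [|q /andP[_ qs]]; last first.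
  by case: eqP => // gq; rewrite gq qs in gs.
apply/esym/eqP; apply: contraNT gs => ag; suff : [set` s] (phi g) by [].
rewrite -sE /=; apply/eqP => /(congr1 (fun f : group_ring R G => coef f g)) /=.
by rewrite /fibre_fun eqxx; apply/eqP.
Qed.

Lemma fibre_component1 : fibre_component 1%g 1 = 1.
Proof.
apply: seriesE => g; rewrite /= /fibre_fun /=.
by case: (g =P 1%g) => [->|]; rewrite ?mult1 ?eqxx //; case: ifP.
Qed.

Lemma fibre_componentM p q a b : fibre_component p a = a ->
  fibre_component q b = b -> fibre_component (p * q)%g (a * b) = a * b.
Proof.
move=> pa qb; apply: seriesE => g; rewrite /= /fibre_fun /=.
case: eqP => // gpq; apply/esym/eqP; apply: contra_notT gpq.
move=> /supp_convolution[x [y [ax bY ->]]]; rewrite gmulfM; congr (_ * _)%g.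
  by move: ax; rewrite -pa /supp /= /fibre_fun; have [//|_] := eqVneq (phi x) p; rewrite eqxx.
by move: bY; rewrite -qb /supp /= /fibre_fun; have [//|_] := eqVneq (phi y) q; rewrite eqxx.
Qed.

Definition group_elt_fun (g : G) : G -> R := fun x => if x == g then 1 else 0.

Lemma group_elt_series g : is_series finite_supports all_coefficients (group_elt_fun g).
Proof.
apply/asboolP; split=> //; apply: sub_finite_set (finite_set1 g) => x.
by rewrite /supp /group_elt_fun /=; have [//|_] := eqVneq x g; rewrite eqxx.
Qed.

Definition group_elt g : group_ring R G := Series (group_elt_series g).

Lemma group_eltM g h : group_elt g * group_elt h = group_elt (g * h)%g.
Proof.
apply: seriesE => x; rewrite series_mulE (@fsum1 _ _ _ g) /= /group_elt_fun.
  by rewrite eqxx mul1r (can2_eq (mulVKg g) (mulKg g)).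
by move=> y /negPf ->; rewrite mul0r.
Qed.

Lemma fibre_component_unit q : exists u v,
  [/\ fibre_component q u = u, u * v = 1 & v * u = 1].
Proof.
have [g gq] := phi_surj q; exists (group_elt g), (group_elt g^-1%g); split.
- apply: seriesE => x; rewrite /= /fibre_fun /= /group_elt_fun.
  by have [->|_] := eqVneq x g; [rewrite gq eqxx | case: ifP].
- by rewrite group_eltM mulgV; apply: seriesE.
- by rewrite group_eltM mulVg; apply: seriesE.
Qed.

Definition group_ring_crossed_product : crossed_product Q (group_ring R G) :=
  CrossedProduct fibre_componentB fibre_componentK fibre_component_finite
    fibre_component_sum fibre_component1 fibre_componentM fibre_component_unit.

End GroupRingCrossedProduct.

(* Only the values at indices i <= n are meaningful. *)
Record central_series (Q : groupType) (n : nat) := CentralSeries {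
  cterm : nat -> set Q;
  cterm0 : cterm 0 = setT;
  ctermn : cterm n = [set 1%g];
  cterm1 : forall i, (i <= n)%N -> cterm i 1%g;
  ctermF : forall i x y, (i <= n)%N ->
    cterm i x -> cterm i y -> cterm i (x / y)%g;
  ctermJ : forall i x y, (i <= n)%N -> cterm i x -> cterm i (x ^ y)%g;
  ctermS : forall i, (i < n)%N -> cterm i.+1 `<=` cterm i;
  cterm_central : forall i x y, (i < n)%N -> cterm i x -> cterm i.+1 [~ x, y]%g }.

Definition nilpotent_group (Q : groupType) : Prop :=
  exists n, inhabited (central_series Q n).

(* The homomorphism chi_i on Q_i / Q_(i+1) is encoded as a function on Q of
   which only the values on Q_i, for i < n, are meaningful. *)
Record multicharacter (K : realType) (Q : groupType) (n : nat) :=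
  Multicharacter {
  mseries : central_series Q n;
  mchar : nat -> Q -> K;
  mcharM : forall i x y, (i < n)%N -> cterm mseries i x -> cterm mseries i y ->
    mchar i (x * y)%g = mchar i x + mchar i y;
  mchar_eq0 : forall i x, (i < n)%N -> cterm mseries i.+1 x -> mchar i x = 0 }.

Section Signs.
Context {K : realType} {Q : groupType} {n : nat}.
Variables (eps : n.-tuple bool) (chi : multicharacter K Q n).

Definition signed_char i x : K := (-1) ^+ nth false eps i * mchar chi i x.

Lemma signed_charM i x y : (i < n)%N ->
  cterm (mseries chi) i x -> cterm (mseries chi) i y ->
  signed_char i (x * y)%g = signed_char i x + signed_char i y.
Proof. by move=> ltin xi yi; rewrite /signed_char mcharM // mulrDr. Qed.

Lemma signed_char_eq0 i x : (i < n)%N -> cterm (mseries chi) i.+1 x ->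
  signed_char i x = 0.
Proof. by move=> ltin xi; rewrite /signed_char mchar_eq0 // mulr0. Qed.

(* (+-chi_0, ..., +-chi_(n-1)), with a minus sign at i iff eps_i = true *)
Definition signed_multicharacter : multicharacter K Q n :=
  Multicharacter signed_charM signed_char_eq0.

End Signs.

Definition right_coset (Q : groupType) (H : set Q) (p : Q) : set Q :=
  [set x | H (x / p)%g].

Section NovikovSupport.
Context {K : realType} {Q : groupType} {n : nat}.
Variable chi : multicharacter K Q n.
Local Notation Q_ := (cterm (mseries chi)).

(* S_i * (Q / Q_i) is Q / Q_i-graded with components S_i u_q, where S_n = S and
   S_i is the chi_i-completion of S_(i+1) * (Q_i / Q_(i+1)). An element of
   S_i u_q is a formal series x = sum_gamma r_gamma u_gamma u_q over
   gamma in Q_i / Q_(i+1), with terms in the components S_(i+1) u_p of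
   S_(i+1) * (Q / Q_(i+1)), p ranging over the cosets Q_(i+1) p in Q_i q.
   Unfolding down to S_n = S, x is a family (x_p)_p of elements x_p of S u_p
   supported on Q_i q, and its term of degree Q_(i+1) p is its restriction to
   Q_(i+1) p. As only the vanishing or not of terms is constrained, membership
   depends only on the support A = {p | x_p <> 0}: for i + m = n,
   novikov_support m i q A says that the families with support A lie in
   S_i u_q. *)
Fixpoint novikov_support (m i : nat) (q : Q) (A : set Q) : Prop :=
  match m with
  | 0 => A `<=` [set q]
  | m'.+1 =>
    [/\ A `<=` right_coset (Q_ i) q,
        forall p, right_coset (Q_ i) q p ->
          novikov_support m' i.+1 p (A `&` right_coset (Q_ i.+1) p) &
        forall t : K, finite_set
          (right_coset (Q_ i.+1) @` [set p | A p /\ mchar chi i (p / q)%g <= t])]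
  end.

Lemma ctermV i x : (i <= n)%N -> Q_ i x -> Q_ i x^-1%g.
Proof. by move=> ltin xi; rewrite -div1g; apply: ctermF => //; exact: cterm1. Qed.

Lemma ctermM i x y : (i <= n)%N -> Q_ i x -> Q_ i y -> Q_ i (x * y)%g.
Proof. by move=> ltin xi yi; rewrite -[y]invgK; apply: ctermF => //; exact: ctermV. Qed.

Lemma ctermJV i x y : (i <= n)%N -> Q_ i x -> Q_ i (y * x / y)%g.
Proof.
move=> ltin xi; have := ctermJ y^-1%g ltin xi.
by rewrite conjgE invgK mulgA.
Qed.

Lemma coset_refl i p : (i <= n)%N -> Q_ i (p / p)%g.
Proof. by rewrite mulgV; exact: cterm1. Qed.

Lemma coset_sym i p q : (i <= n)%N -> Q_ i (p / q)%g -> Q_ i (q / p)%g.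
Proof. by move=> ltin /(ctermV ltin); rewrite invgF. Qed.

Lemma coset_trans i p q r : (i <= n)%N ->
  Q_ i (p / q)%g -> Q_ i (q / r)%g -> Q_ i (p / r)%g.
Proof. by move=> ltin pq qr; rewrite -(divgKA q); exact: ctermM. Qed.

Lemma coset_mul i a b p q : (i <= n)%N ->
  Q_ i (a / p)%g -> Q_ i (b / q)%g -> Q_ i (a * b / (p * q))%g.
Proof.
move=> ltin ap bq.
have -> : (a * b / (p * q) = (a * (b / q) / a) * (a / p))%g.
  by rewrite invgM !mulgA mulgVK.
by apply: ctermM => //; exact: ctermJV.
Qed.

Lemma coset_eq i p q : (i <= n)%N ->
  Q_ i (p / q)%g -> right_coset (Q_ i) p = right_coset (Q_ i) q.
Proof.
move=> ltin pq; apply/seteqP; split=> x; rewrite /right_coset /= => xp.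
  exact: (coset_trans ltin xp pq).
exact: (coset_trans ltin xp (coset_sym ltin pq)).
Qed.

Lemma coset_repsP i (D : set Q) : (i <= n)%N ->
  finite_set (right_coset (Q_ i) @` D) <->
  exists s : seq Q, (forall p, p \in s -> D p) /\
    forall p, D p -> exists2 p', p' \in s & Q_ i (p / p')%g.
Proof.
move=> ltin; split=> [/finite_seqP[S SE]|[s [_ Ds]]]; last first.
  have /sub_finite_set : right_coset (Q_ i) @` D `<=`
      right_coset (Q_ i) @` [set` s].
    by move=> _ [p Dp <-]; have [p' ps pp'] := Ds p Dp; exists p' => //;
       rewrite (coset_eq ltin pp').
  by apply; apply: finite_image; exact: finite_seq.
have : forall E, E \in S -> exists2 p, D p & right_coset (Q_ i) p = E.
  by move=> E ES; have : [set` S] E by []; rewrite -SE.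
move=> SD.
have [s [sD sS]] : exists s : seq Q, (forall p, p \in s -> D p) /\
    forall E, E \in S -> exists2 p, p \in s & right_coset (Q_ i) p = E.
  elim: S {SE} SD => [|E S IH] SD; first by exists [::].
  have [|s [sD sS]] := IH; first by move=> F FS; apply: SD; rewrite inE FS orbT.
  have [p Dp pE] := SD E (mem_head _ _); exists (p :: s); split.
    by move=> r; rewrite inE => /predU1P[->|/sD].
  move=> F; rewrite inE => /predU1P[->|/sS[r rs rF]].
    by exists p; rewrite ?mem_head.
  by exists r; rewrite // inE rs orbT.
exists s; split=> // p Dp.
have : (right_coset (Q_ i) @` D) (right_coset (Q_ i) p) by exists p.
rewrite SE => /sS[p' ps pp']; exists p' => //.
by rewrite -[Q_ i _]/(right_coset (Q_ i) p' p) pp'; exact: coset_refl.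
Qed.

Lemma novikov_support_sub m i q (A B : set Q) : A `<=` B ->
  novikov_support m i q B -> novikov_support m i q A.
Proof.
elim: m i q A B => [|m IH] i q A B AB /=; first exact: subset_trans.
move=> [B1 B2 B3]; split=> [x /AB /B1 //|p pq|t].
  by apply: IH (B2 p pq); exact: setSI.
by apply: sub_finite_set (B3 t); apply: image_subset => p [/AB Bp pt].
Qed.

Lemma novikov_support0 m i q : novikov_support m i q set0.
Proof.
elim: m i q => [|m IH] i q //=; split=> // [p _|t]; first by rewrite set0I.
by rewrite (_ : [set p | _] = set0) ?image_set0 //; apply/seteqP; split=> p [].
Qed.

Lemma novikov_supportU m i q (A B : set Q) : novikov_support m i q A ->
  novikov_support m i q B -> novikov_support m i q (A `|` B).
Proof.
elim: m i q A B => [|m IH] i q A B /=; first by rewrite subUset.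
move=> [A1 A2 A3] [B1 B2 B3]; split=> [|p pq|t]; first by rewrite subUset.
  by rewrite setIUl; apply: IH; [exact: A2|exact: B2].
have := conj (A3 t) (B3 t); rewrite -finite_setU -image_setU.
by apply: sub_finite_set; apply: image_subset => p [[Ap|Bp] pt]; [left|right].
Qed.

Lemma novikov_support_shift m i q q' A : (i + m = n)%N -> Q_ i (q' / q)%g ->
  novikov_support m i q A -> novikov_support m i q' A.
Proof.
case: m => [|m] /= imn qq'.
  suff -> : q' = q by [].
  move: qq'; rewrite -[i]addn0 imn ctermn /= => /eqP.
  by rewrite divg_eq1 => /eqP.
have ltin : (i < n)%N by rewrite -imn addnS ltnS leq_addr.
have lein := ltnW ltin.
move=> [A1 A2 A3]; split=> [|p pq|t].
- by rewrite (coset_eq lein qq').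
- by apply: A2; rewrite -(coset_eq lein qq').
- apply: sub_finite_set (A3 (t + mchar chi i (q' / q)%g)); apply: image_subset.
  move=> p [Ap pt]; split=> //; have pq := A1 _ Ap.
  have pq' : Q_ i (p / q')%g by apply: coset_trans pq (coset_sym _ qq').
  by rewrite -(divgKA q') mcharM // lerD2r.
Qed.

Lemma novikov_support1 m i q : (i + m = n)%N -> novikov_support m i q [set q].
Proof.
elim: m i => [|m IH] i /= imn; first exact: subset_refl.
have ltin : (i < n)%N by rewrite -imn addnS ltnS leq_addr.
have imn' : (i.+1 + m = n)%N by rewrite addSnnS.
split=> [_ ->|p pq|t]; first exact: (coset_refl _ (ltnW ltin)).
  have [qp|qp] := pselect (Q_ i.+1 (q / p)%g).
    apply: (novikov_support_sub (B := [set q])); first exact: subIsetl.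
    by apply: (novikov_support_shift imn' (coset_sym ltin qp)); exact: IH.
  rewrite (_ : _ `&` _ = set0); first exact: novikov_support0.
  by apply/seteqP; split=> // x [->].
apply: sub_finite_set (finite_image (right_coset (Q_ i.+1)) (finite_set1 q)).
by apply: image_subset => p [].
Qed.

Lemma seq_lower_bound (f : Q -> K) (s : seq Q) :
  exists2 b, b <= 0 & forall p, p \in s -> b <= f p.
Proof.
elim: s => [|p s [b b0 bs]]; first by exists 0.
exists (Num.min b (f p)); first by rewrite ge_min b0.
move=> r; rewrite inE => /predU1P[->|/bs br]; first by rewrite ge_min lexx orbT.
by rewrite ge_min br.
Qed.

Lemma mchar_coset i p p' q : (i < n)%N -> Q_ i (p' / q)%g ->
  Q_ i.+1 (p / p')%g -> mchar chi i (p / q)%g = mchar chi i (p' / q)%g.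
Proof.
move=> ltin p'q pp'; rewrite -(divgKA p') mcharM //; last exact: ctermS pp'.
by rewrite (mchar_eq0 ltin pp') add0r.
Qed.

Lemma mchar_mul i a b q q' : (i < n)%N -> Q_ i (a / q)%g -> Q_ i (b / q')%g ->
  mchar chi i (a * b / (q * q'))%g =
  mchar chi i (a / q)%g + mchar chi i (b / q')%g.
Proof.
move=> ltin aq bq; have lein := ltnW ltin.
have -> : (a * b / (q * q') = (a / q) * (q * (b / q') / q))%g.
  by rewrite invgM !mulgA mulgVK.
rewrite mcharM //; last exact: ctermJV.
congr (_ + _).
have -> : (q * (b / q') / q = (b / q') * [~ b / q', q^-1])%g.
  by rewrite commgEl conjgE invgK mulVKg !mulgA.
have cen : Q_ i.+1 [~ b / q', q^-1]%g by exact: cterm_central.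
by rewrite mcharM // ?(mchar_eq0 ltin cen) ?addr0 //; exact: ctermS cen.
Qed.

Section Product.
Variables (m i : nat) (q q' : Q) (A B : set Q).
Context (imn : (i + m.+1 = n)%N).
Context (SA : novikov_support m.+1 i q A) (SB : novikov_support m.+1 i q' B).

Let ltin : (i < n)%N. Proof. by rewrite -imn addnS ltnS leq_addr. Qed.

Lemma novikov_lower_bound r D : novikov_support m.+1 i r D ->
  exists b, forall a, D a -> b <= mchar chi i (a / r)%g.
Proof.
move=> [D1 _ /(_ 0) /(coset_repsP _ ltin)[s [sD Ds]]].
have [b b0 bs] := seq_lower_bound (fun p => mchar chi i (p / r)%g) s.
exists b => a Da; have [|a0] := leP (mchar chi i (a / r)%g) 0; last first.
  exact: le_trans b0 (ltW a0).
move=> a0; have [a' as' aa'] := Ds a (conj Da a0).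
rewrite (mchar_coset ltin _ aa') ?bs //.
by apply: D1; have [] := sD _ as'.
Qed.

Lemma novikov_product_reps t : exists sA sB : seq Q,
  [/\ forall a, a \in sA -> A a, forall b, b \in sB -> B b &
   forall a b, A a -> B b -> mchar chi i (a * b / (q * q'))%g <= t ->
    exists a' b', [/\ a' \in sA, b' \in sB, Q_ i.+1 (a / a')%g &
      Q_ i.+1 (b / b')%g]].
Proof.
have [lA lAP] := novikov_lower_bound SA; have [lB lBP] := novikov_lower_bound SB.
have [A1 _ /(_ (t - lB)) /(coset_repsP _ ltin)[sA [sAA sAP]]] := SA.
have [B1 _ /(_ (t - lA)) /(coset_repsP _ ltin)[sB [sBB sBP]]] := SB.
exists sA, sB; split=> [a /sAA[]//|b /sBB[]//|a b Aa Bb].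
rewrite mchar_mul ?A1 ?B1 //; [|exact: A1|exact: B1] => abt.
have [|a' a's aa'] := sAP a.
  by split=> //; rewrite lerBrDr; apply: le_trans abt; rewrite lerD2l lBP.
have [|b' b's bb'] := sBP b.
  by split=> //; rewrite lerBrDl; apply: le_trans abt; rewrite lerD2r lAP.
by exists a', b'.
Qed.

End Product.

Lemma novikov_support_bigU (I : eqType) m i q (s : seq I) (F : I -> set Q) :
  (forall j, j \in s -> novikov_support m i q (F j)) ->
  novikov_support m i q [set x | exists2 j, j \in s & F j x].
Proof.
elim: s => [|j s IH] Fs.
  by apply: novikov_support_sub (novikov_support0 m i q) => x [].
apply: (novikov_support_sub (B := F j `|` [set x | exists2 j, j \in s & F j x])).
  move=> x [k]; rewrite inE => /predU1P[-> ?|ks Fk]; [by left|].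
  by right; exists k.
apply: novikov_supportU; first by apply: Fs; rewrite mem_head.
by apply: IH => k ks; apply: Fs; rewrite inE ks orbT.
Qed.

Lemma novikov_supportM m i q q' (A B : set Q) : (i + m = n)%N ->
  novikov_support m i q A -> novikov_support m i q' B ->
  novikov_support m i (q * q')%g (set_mulg A B) /\
  forall x, finite_set [set a | A a /\ B (a^-1 * x)%g].
Proof.
elim: m i q q' A B => [|m IH] i q q' A B imn.
  move=> Aq Bq; split=> [_ [a [b [/Aq-> /Bq-> ->]]] //|x].
  by apply: sub_finite_set (finite_set1 q) => a [/Aq].
have ltin : (i < n)%N by rewrite -imn addnS ltnS leq_addr.
have lein := ltnW ltin; have imn' : (i.+1 + m = n)%N by rewrite addSnnS.
move=> SA SB; have [A1 A2 A3] := SA; have [B1 B2 B3] := SB.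
pose A' a := A `&` right_coset (Q_ i.+1) a.
pose B' b := B `&` right_coset (Q_ i.+1) b.
have IH' a b : A a -> B b -> novikov_support m i.+1 (a * b)%g (set_mulg (A' a) (B' b)) /\
    forall x, finite_set [set c | A' a c /\ B' b (c^-1 * x)%g].
  by move=> Aa Bb; apply: IH => //; [exact/A2/A1 | exact/B2/B1].
split; first split.
- by move=> _ [a [b [/A1 Aa /B1 Bb ->]]]; exact: coset_mul.
- move=> p pq.
  have [sA [sB [sAA sBB sAB]]] :=
    novikov_product_reps imn SA SB (mchar chi i (p / (q * q'))%g).
  apply: (novikov_support_sub (B := [set x | exists2 ab,
      ab \in [seq (a, b) | a <- sA, b <- sB] &
      (set_mulg (A' ab.1) (B' ab.2) `&` right_coset (Q_ i.+1) p) x])).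
    move=> x [[a [b [Aa Bb xE]]] xp].
    have [|a' [b' [a's b's aa' bb']]] := sAB a b Aa Bb.
      by rewrite -xE (mchar_coset ltin pq xp).
    exists (a', b'); first by apply/allpairsP; exists (a', b').
    by split=> //; exists a, b.
  apply: novikov_support_bigU => _ /allpairsP[[a b] /= [/sAA Aa /sBB Bb ->]] /=.
  have [abp|abp] := pselect (Q_ i.+1 (p / (a * b))%g).
    apply: (novikov_support_sub (@subIsetl _ _ _)).
    by apply: (novikov_support_shift imn' abp); have [] := IH' a b Aa Bb.
  apply: (novikov_support_sub (B := set0)); last exact: novikov_support0.
  move=> x [[c [d [[_ ca] [_ db] ->]]] cdp]; apply: abp.
  apply: (coset_trans ltin (coset_sym ltin cdp)).
  exact: coset_mul.
- move=> t; apply/(coset_repsP _ ltin).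
  have [sA [sB [sAA sBB sAB]]] := novikov_product_reps imn SA SB t.
  pose s := [seq (a * b)%g | a <- sA, b <- sB].
  exists [seq x <- s | mchar chi i (x / (q * q'))%g <= t]; split.
    move=> x; rewrite mem_filter => /andP[xt /allpairsP[[a b] /= [/sAA Aa /sBB Bb xE]]].
    by split=> //; exists a, b.
  move=> _ [[a [b [Aa Bb ->]]] abt].
  have [a' [b' [a's b's aa' bb']]] := sAB a b Aa Bb abt.
  exists (a' * b')%g; last exact: coset_mul.
  rewrite mem_filter; apply/andP; split; last by apply/allpairsP; exists (a', b').
  rewrite -(@mchar_coset i (a * b)%g (a' * b')%g _ ltin) //; last exact: coset_mul.
  by apply: coset_mul => //; [exact/A1/sAA | exact/B1/sBB].
- move=> x.
  have [sA [sB [sAA sBB sAB]]] :=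
    novikov_product_reps imn SA SB (mchar chi i (x / (q * q'))%g).
  apply: (sub_finite_set (B := \bigcup_(ab in [set` [seq (a, b) | a <- sA, b <- sB]])
      [set c | A' ab.1 c /\ B' ab.2 (c^-1 * x)%g])).
    move=> a [Aa Bb]; have [|a' [b' [a's b's aa' bb']]] := sAB a _ Aa Bb.
      by rewrite mulVKg.
    by exists (a', b') => //=; apply/allpairsP; exists (a', b').
  apply: bigcup_finite; first exact: finite_seq.
  move=> _ /allpairsP[[a b] /= [/sAA Aa /sBB Bb ->]] /=.
  by have [_] := IH' a b Aa Bb.
Qed.

(* The supports of the elements of S_0. *)
Definition novikov_supports : support_family Q.
Proof.
refine (@SupportFamily Q (novikov_support n 0 1%g)
  (fun A B => @novikov_support_sub n 0 1%g A B)
  (fun A B => @novikov_supportU n 0 1%g A B)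
  (novikov_support1 _ (add0n n)) _ _) => A B.
- move=> SA SB; rewrite -[X in novikov_support _ _ X _]mulg1.
  by have [] := novikov_supportM (add0n n) SA SB.
- by move=> x SA SB; have [_] := novikov_supportM (add0n n) SA SB.
Defined.

End NovikovSupport.

(* The completion of C = S * Q: its elements, the formal series sum_q r_q u_q,
   are the families (r_q u_q)_q in the product of the homogeneous components of
   C. *)
Definition novikov_ring (K : realType) (Q : groupType) (n : nat)
    (chi : multicharacter K Q n) (C : nzRingType) (X : crossed_product Q C) :
    nzRingType :=
  series (novikov_supports chi) (homogeneous_coefficients X).

Section NovikovInclusion.
Context {K : realType} {Q : groupType} {n : nat}.
Variable chi : multicharacter K Q n.
Context {C : nzRingType}.
Variable X : crossed_product Q C.

Lemma finite_novikov_support (A : set Q) :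
  finite_set A -> novikov_supports chi A.
Proof.
move=> /finite_uniq_seq[s _ ->].
apply: (support_sub (B := [set x | exists2 q, q \in s & [set q] x])).
  by move=> q qs; exists q.
apply: novikov_support_bigU => q _.
apply: (novikov_support_shift (add0n n) (q := q)); first by rewrite cterm0.
exact: novikov_support1.
Qed.

Lemma components_series (c : C) : is_series (novikov_supports chi)
  (homogeneous_coefficients X) (fun q => component X q c).
Proof.
apply/asboolP; split; last by move=> q; exact: component_homogeneous.
exact: finite_novikov_support (component_finite X c).
Qed.

Definition novikov_inclusion (c : C) : novikov_ring chi X :=
  Series (components_series c).

Lemma novikov_inclusion_nmod : nmod_morphism novikov_inclusion.
Proof.
split=> [|a b]; apply: seriesE => q; first exact: component0.
exact: componentD.
Qed.

Lemma novikov_inclusion_monoid : monoid_morphism novikov_inclusion.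
Proof.
split=> [|a b]; apply: seriesE => q; last exact: component_mul.
rewrite /= -(component1 X) componentK.
by case: eqP => // _; exact: component1.
Qed.

HB.instance Definition _ :=
  GRing.isNmodMorphism.Build _ _ novikov_inclusion novikov_inclusion_nmod.
HB.instance Definition _ :=
  GRing.isMonoidMorphism.Build _ _ novikov_inclusion novikov_inclusion_monoid.

End NovikovInclusion.

Definition novikov_module (K : realType) (R : nzRingType) (G Q : groupType)
    (phi : {multiplicative G -> Q}) (phi_surj : forall q, exists g, phi g = q)
    (n : nat) (chi : multicharacter K Q n) : lmodType (group_ring R G) :=
  let RG := group_ring_crossed_product (R := R) phi_surj in
  restrict_scalars (novikov_inclusion chi RG) (novikov_ring chi RG)^o.

(* Main.v *)
(* Let P be a projective RG-resolution with P_d finitely generated, D : P_d -> P_(d-1)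
   its differential, and x = sum_j c_j(x) e_j a finite dual basis of P_d. The
   hypothesis extends each c_j along D to maps g_j^eps into the completions of RG,
   one for each choice of signs eps. Fix representatives r_i(q) of the cosets Q_i q,
   and attach to q the signs of the numbers chi_i(q / r_i(q)); this partitions Q
   into 2^n classes W_eps such that W_eps meets the support of any element of the
   eps-completion in a finite set. Hence, for every RN-linear map f : P_d -> M, where
   N = ker phi, the finite sum
     h(y) = sum_eps sum_(q in W_eps) sum_j f(g_j^eps(y)_q e_j)
   defines an RN-linear map, and h D = f since the terms of degree q of c_j(x) add up
   to c_j(x). As P is also a projective RN-resolution, H^m(N; M) = 0 for m >= d. *)
From HB Require Import structures.
Require Import Defs.
From mathcomp Require Import all_boot all_order all_algebra.
From mathcomp Require Import reals ereal.
From mathcomp Require Import boolp classical_sets functions cardinality fsbigop.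

Set Implicit Arguments.
Unset Strict Implicit.
Unset Printing Implicit Defensive.

Import Order.TTheory GRing.Theory Num.Theory.

Local Open Scope ring_scope.

(** * Finitely supported sums with values in an abelian group *)

Section FiniteSums.
Local Open Scope classical_set_scope.
Context {T : choiceType} {V : zmodType}.
Implicit Types f g : T -> V.

Lemma finsum_seq f (s : seq T) : uniq s -> (forall x, f x != 0 -> x \in s) ->
  \sum_(x \in [set: T]) f x = \sum_(x <- s) f x.
Proof.
move=> us fs; rewrite (fsbigE s) //.
  by apply: eq_bigl => x; rewrite in_setT.
by move=> x _ xs; apply/eqP; apply: contraNT xs => /fs.
Qed.

Lemma finite_cover f : finite_set [set x | f x != 0] ->
  exists2 s : seq T, uniq s & forall x, f x != 0 -> x \in s.
Proof.
move=> /finite_uniq_seq[s us sE]; exists s => // x fx.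
by have : [set` s] x by rewrite -sE.
Qed.

End FiniteSums.

Section FiniteSumMorphisms.
Local Open Scope classical_set_scope.
Context {T : choiceType} {V : zmodType}.
Implicit Types f g : T -> V.

Lemma finsum_morph (W : zmodType) (h : V -> W) f :
  h 0 = 0 -> (forall a b, h (a + b) = h a + h b) ->
  finite_set [set x | f x != 0] ->
  h (\sum_(x \in [set: T]) f x) = \sum_(x \in [set: T]) h (f x).
Proof.
move=> h0 hD /finite_cover[s us fs]; rewrite (finsum_seq us fs).
rewrite (big_morph h hD h0); apply/esym/finsum_seq => // x hfx.
by apply: fs; apply: contraNneq hfx => ->; rewrite h0.
Qed.

Lemma finsumD f g : finite_set [set x | f x != 0] -> finite_set [set x | g x != 0] ->
  \sum_(x \in [set: T]) (f x + g x) =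
  \sum_(x \in [set: T]) f x + \sum_(x \in [set: T]) g x.
Proof.
move=> /finite_cover[s _ fs] /finite_cover[t _ gt].
have u := undup_uniq (s ++ t).
have fu x : f x != 0 -> x \in undup (s ++ t).
  by move=> /fs xs; rewrite mem_undup mem_cat xs.
have gu x : g x != 0 -> x \in undup (s ++ t).
  by move=> /gt xt; rewrite mem_undup mem_cat xt orbT.
rewrite (finsum_seq u fu) (finsum_seq u gu) (finsum_seq u) ?big_split // => x.
by have [->|/fu//] := eqVneq (f x) 0; rewrite add0r => /gu.
Qed.

End FiniteSumMorphisms.

(** * Projective modules and dual bases *)

Section LinearMaps.
Local Open Scope classical_set_scope.
Context {A : nzRingType}.
Implicit Types M U V P : lmodType A.

Lemma linear_exists M V (f : M -> V) : linear f ->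
  exists g : {linear M -> V}, forall x, g x = f x.
Proof.
move=> lf; pose F := GRing.isLinear.Build A M V _ f lf.
by exists (HB.pack_for {linear M -> V} f F).
Qed.

Lemma linear_finsum (T : choiceType) M V (l : T -> M -> V) :
  (forall t, linear (l t)) -> (forall x, finite_set [set t | l t x != 0]) ->
  linear (fun x => \sum_(t \in [set: T]) l t x).
Proof.
move=> lin fin a x y.
rewrite (finsum_morph (h := fun v => a *: v)) ?scaler0 //; last first.
  by move=> u v; rewrite scalerDr.
rewrite -finsumD //; first by apply: eq_fsbigr => t _; exact: lin.
apply: sub_finite_set (fin x) => t /=; apply: contraNneq => ->.
by rewrite scaler0.
Qed.

(** Having such a family is equivalent to being projective, by [dual_basis_projective] and
    [projective_dual_basis]. In this form projectivity passes explicitly from [RG] to the group ring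
    of the kernel. *)
Definition dual_basis P (T : choiceType) (e : T -> P) (c : T -> P -> A) : Prop :=
  [/\ forall t, scalar (c t), forall x, finite_set [set t | c t x != 0] &
    forall x, x = \sum_(t \in [set: T]) c t x *: e t].

Section DualBasis.
Variables (P : lmodType A) (T : choiceType) (e : T -> P) (c : T -> P -> A).
Hypothesis db : dual_basis e c.

Lemma dual_basis_linear V (v : T -> V) :
  linear (fun x => \sum_(t \in [set: T]) c t x *: v t).
Proof.
have [lin fin _] := db.
apply: linear_finsum => [t a x y|x]; first by rewrite lin scalerDl scalerA.
by apply: sub_finite_set (fin x) => t /=; apply: contraNneq => ->; rewrite scale0r.
Qed.

Lemma dual_basis_morph V (f : {linear P -> V}) x :
  f x = \sum_(t \in [set: T]) c t x *: f (e t).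
Proof.
have [_ fin ex] := db; rewrite {1}(ex x) finsum_morph ?linear0 //.
- by apply: eq_fsbigr => t _; rewrite linearZ.
- exact: linearD.
- by apply: sub_finite_set (fin x) => t /=; apply: contraNneq => ->; rewrite scale0r.
Qed.

Lemma dual_basis_lift U V (p : {linear U -> V}) (f : {linear P -> V}) :
  (forall x, exists u, p u = f x) ->
  exists g : {linear P -> U}, forall x, p (g x) = f x.
Proof.
move=> pf; have [u ue] := choice (fun t => pf (e t)).
have [g gE] := linear_exists (dual_basis_linear u).
exists g => x; have [_ fin _] := db.
rewrite gE (dual_basis_morph f) finsum_morph ?linear0 //.
- by apply: eq_fsbigr => t _; rewrite linearZ ue.
- exact: linearD.
- by apply: sub_finite_set (fin x) => t /=; apply: contraNneq => ->; rewrite scale0r.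
Qed.

Lemma dual_basis_projective : projective P.
Proof. by move=> U V p f sp; apply: dual_basis_lift => x; exact: sp. Qed.

End DualBasis.

Section FreeModule.
Variable T : choiceType.

Definition finitely_supported : {pred T -> A^o} :=
  fun f => `[< finite_set [set t | f t != 0] >].

Record free_module := FreeModule {
  free_coef : T -> A^o; _ : finitely_supported free_coef }.

HB.instance Definition _ := [isSub for free_coef].
HB.instance Definition _ := [Choice of free_module by <:].

Lemma finitely_supported_submod : GRing.submod_closed finitely_supported.
Proof.
split=> [|a f g /asboolP ff /asboolP fg]; apply/asboolP.
  by apply: sub_finite_set (finite_set0 T) => t /=; rewrite eqxx.
have fU : finite_set ([set t | f t != 0] `|` [set t | g t != 0]).
  by rewrite finite_setU.
apply: sub_finite_set fU => t /=.
rewrite -[(a *: f + g) t]/(a * f t + g t).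
by have [->|] := eqVneq (f t) 0; [rewrite mulr0 add0r; right | left].
Qed.

HB.instance Definition _ :=
  GRing.isSubmodClosed.Build A (T -> A^o) finitely_supported finitely_supported_submod.
HB.instance Definition _ := [SubChoice_isSubLmodule of free_module by <:].

Lemma free_coef_finite (f : free_module) : finite_set [set t | free_coef f t != 0].
Proof. by case: f => f ff; apply/asboolP. Qed.

Lemma free_coef_scalar t : scalar (fun f : free_module => free_coef f t : A).
Proof. by []. Qed.

Lemma free_delta_subproof t0 : finitely_supported (fun t => (t == t0)%:R : A^o).
Proof.
apply/asboolP; apply: sub_finite_set (finite_set1 t0) => t /=.
by have [//|_] := eqVneq t t0; rewrite eqxx.
Qed.

Definition free_delta t0 : free_module := FreeModule (free_delta_subproof t0).

End FreeModule.

(** The canonical surjection onto [P] from the free module on all elements of [P] splits, and the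
    coordinates of the splitting are the required functionals. *)
Lemma projective_dual_basis P : projective P ->
  exists c : P -> P -> A, dual_basis id c.
Proof.
move=> prP; pose F : lmodType A := free_module P.
have lin : linear (fun f : F => \sum_(x \in [set: P]) (free_coef f x : A) *: x).
  apply: linear_finsum => [x a f g|f].
    by rewrite free_coef_scalar scalerDl scalerA.
  apply: sub_finite_set (free_coef_finite f) => x /=.
  by apply: contraNneq => ->; rewrite scale0r.
have [ev evE] := linear_exists lin.
have idl : linear (id : P -> P) by [].
have [i iE] := linear_exists idl.
have [|s sE] := prP F P ev i.
  move=> x; exists (free_delta x); rewrite evE (@finsum_seq _ _ _ [:: x]) //.
    by rewrite big_seq1 /= eqxx scale1r.
  by move=> y; rewrite inE /=; apply: contraNT => /negPf ->; rewrite scale0r.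
exists (fun y x => free_coef (s x) y); split=> [y a x x'|x|x].
- by rewrite linearP.
- exact: free_coef_finite.
- by rewrite -[LHS]iE -sE evE.
Qed.

(** Here [p] need only hit the image of [f]. This lets chain maps and homotopies be lifted through
    differentials without forming submodules of cycles. *)
Lemma projective_lift P U V (p : {linear U -> V}) (f : {linear P -> V}) :
  projective P -> (forall x, exists u, p u = f x) ->
  exists g : {linear P -> U}, forall x, p (g x) = f x.
Proof. by move=> /projective_dual_basis[c db] pf; exact: (dual_basis_lift db pf). Qed.

(** A finite generating family gives a surjection from a module of row vectors, which splits. *)
Lemma finitely_generated_dual_basis P : projective P -> finitely_generated P ->
  exists (k : nat) (e : 'I_k -> P) (c : 'I_k -> P -> A),
    (forall i, scalar (c i)) /\ forall x, x = \sum_i c i x *: e i.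
Proof.
move=> prP [s gs].
have lin : linear (fun v : 'rV[A]_(size s) => \sum_i v 0 i *: s`_i).
  move=> a u v; rewrite scaler_sumr -big_split; apply: eq_bigr => i _.
  by rewrite !mxE scalerDl scalerA.
have [ev evE] := linear_exists lin.
have idl : linear (id : P -> P) by [].
have [i iE] := linear_exists idl.
have [|g gE] := prP _ _ ev i.
  move=> x; have [c ->] := gs x; exists (\row_j c j); rewrite evE.
  by apply: eq_bigr => j _; rewrite mxE.
exists (size s), (fun i => s`_i), (fun i x => g x 0 i); split.
  by move=> j a x y; rewrite linearP !mxE.
by move=> x; rewrite -evE gE iE.
Qed.

End LinearMaps.

(** * Comparison of projective resolutions *)

Section Comparison.
Context {A : nzRingType} {B : lmodType A}.
Implicit Types P : projective_resolution B.

(** In degree 0 the augmentation serves as differential, so that cycles are boundaries in every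
    degree. *)
Definition cycle P i : res P i -> Prop :=
  match i with
  | 0 => fun x => res_aug P x = 0
  | k.+1 => fun x => res_d P k x = 0
  end.

Lemma cycleP P i x : @cycle P i x <-> exists y, res_d P i y = x.
Proof. by case: i x => [|i] x /=; [exact: res_exact0 | exact: res_exact]. Qed.

(* Degree i part of chain maps a : P' -> P and b : P -> P' over B, together with
   a homotopy h from b a to the identity; the conditions are chosen so that
   degree i + 1 can be built knowing them in degree i only. *)
Definition comparable P P' (M : lmodType A) i : Prop :=
  exists (a : {linear res P' i -> res P i}) (b : {linear res P i -> res P' i})
         (h : {linear res P' i -> res P' i.+1}),
  [/\ forall x, cycle x -> cycle (a x), forall x, cycle x -> cycle (b x),
      forall x, cycle x -> res_d P' i (h x) = x - b (a x) &
      forall f : {linear res P' i -> M}, cocycle f ->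
        coboundary (P := P) (f \o b : {linear res P i -> M}) -> coboundary f].

Lemma comparable0 P P' M : comparable P P' M 0.
Proof.
have [||a aE] := projective_lift (p := res_aug P) (f := res_aug P').
- exact: res_projective.
- by move=> x; exact: res_aug_surj.
have [||b bE] := projective_lift (p := res_aug P') (f := res_aug P).
- exact: res_projective.
- by move=> x; exact: res_aug_surj.
have [k kE] : exists k : {linear res P' 0 -> res P' 0}, forall x, k x = x - b (a x).
  by exists (idfun \- (b \o a)).
have [||h hE] := projective_lift (p := res_d P' 0) (f := k).
- exact: res_projective.
- move=> x; apply/(cycleP (P := P')); rewrite /= kE linearB /= bE aE.
  exact: subrr.
exists a, b, h; split=> [x|x|x _|f fc fb] /=.
- by rewrite aE.
- by rewrite bE.
- by rewrite hE kE.
(* The difference [x - b (a x)] is the boundary of [h x], which the cocycle [f] kills; a coboundary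
   in degree 0 is zero, so [f] also kills [b (a x)]. *)
move=> x; rewrite -[x](subrK (b (a x))) -kE -hE linearD fc add0r.
exact: fb.
Qed.

Lemma comparableS P P' M i : comparable P P' M i -> comparable P P' M i.+1.
Proof.
move=> [a [b [h [ac bc hE _]]]].
have dd P0 j (x : res P0 j.+1) : cycle (res_d P0 j x).
  by apply/cycleP; exists x.
have [||a' a'E] := projective_lift (p := res_d P i)
  (f := a \o res_d P' i : {linear _ -> _}).
- exact: res_projective.
- by move=> x; apply/cycleP/ac.
have [||b' b'E] := projective_lift (p := res_d P' i)
  (f := b \o res_d P i : {linear _ -> _}).
- exact: res_projective.
- by move=> x; apply/cycleP/bc.
(* The usual homotopy formula. The values of [k] are cycles because [res_d P' i x] is a cycle, where
   the identity for [h] in degree [i] applies. *)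
have [k kE] : exists k : {linear res P' i.+1 -> res P' i.+1},
    forall x, k x = x - b' (a' x) - h (res_d P' i x).
  by exists (idfun \- (b' \o a') \- (h \o res_d P' i)).
have [||h' h'E] := projective_lift (p := res_d P' i.+1) (f := k).
- exact: res_projective.
- move=> x; apply/(cycleP (P := P')); rewrite /= kE !linearB /= b'E /= a'E /=.
  by rewrite hE ?subKr ?subrr.
exists a', b', h'; split=> [x /= x0|x /= x0|x /= x0|f fc [g gE]] /=.
- by rewrite a'E /= x0 linear0.
- by rewrite b'E /= x0 linear0.
- by rewrite h'E kE x0 linear0 subr0.
(* Write [x] as the sum of the boundary of [h' x], of [h (res_d P' i x)] and of [b' (a' x)]. The
   cocycle [f] kills the first term, and on the last it equals [g (a (res_d P' i x))]. *)
exists ((g \o a) \+ (f \o h)) => x /=; rewrite -[x in LHS](subrK (b' (a' x))).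
rewrite -[x - _](subrK (h (res_d P' i x))) -kE -h'E !linearD fc add0r addrC.
by have /= -> := gE (a' x); rewrite a'E.
Qed.

(** Since [Ext_eq0] quantifies over all resolutions, this reduces it to one: a cocycle is pulled
    back along [b], and [comparable] carries the coboundary property back. *)
Lemma Ext_eq0_resolution P n (M : lmodType A) :
  (forall f : {linear res P n -> M}, cocycle f -> coboundary f) -> Ext_eq0 n B M.
Proof.
move=> PM P' f fc; have : comparable P P' M n.
  by elim: n {PM f fc} => [|n]; [exact: comparable0 | exact: comparableS].
move=> [a [b [h [_ bc _]]]]; apply => //; apply: PM => y /=.
have /cycleP/bc/cycleP[z <-] : exists z, res_d P n z = res_d P n y by exists y.
exact: fc.
Qed.

End Comparison.

(** * Restriction of modules and resolutions to the kernel *)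

Section KernelRing.
Local Open Scope classical_set_scope.
Context {R : nzRingType} {G Q : groupType}.
Variable phi : {multiplicative G -> Q}.
Local Notation N := (kernel phi).
Local Notation RG := (group_ring R G).
Local Notation RN := (group_ring R N).

Lemma finsum_kernel (V : zmodType) (F : G -> V) : finite_set [set g | F g != 0] ->
  (forall g, F g != 0 -> in_kernel phi g) ->
  \sum_(g \in [set: G]) F g = \sum_(n \in [set: N]) F (val n).
Proof.
move=> fin FN.
have finN : finite_set [set n : N | F (val n) != 0].
  by apply: finite_preimage fin => ? ? _ _; exact: val_inj.
have [s us sF] := finite_cover finN.
rewrite (finsum_seq us sF) -(big_map val xpredT F); apply: finsum_seq.
  by rewrite map_inj_uniq //; exact: val_inj.
move=> g Fg; have gN := FN g Fg.
by rewrite -[g](SubK N gN) map_f //; apply: sF; rewrite SubK.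
Qed.

Definition kernel_extend_fun (b : RN) (g : G) : R :=
  if insub g is Some n then coef b n else 0.

Lemma kernel_extend_neq0 b g : kernel_extend_fun b g != 0 -> in_kernel phi g.
Proof. by rewrite /kernel_extend_fun; case: insubP => // _; rewrite eqxx. Qed.

Lemma kernel_extend_series b :
  is_series (@finite_supports G) all_coefficients (kernel_extend_fun b).
Proof.
apply/asboolP; split=> //.
apply: sub_finite_set (finite_image val (group_ring_finite b)) => g /=.
rewrite /supp /= /kernel_extend_fun; case: insubP => [n _ <- bn|_]; last by rewrite eqxx.
by exists n.
Qed.

Definition kernel_extend (b : RN) : RG := Series (kernel_extend_series b).

Lemma kernel_extend_val b (n : N) : coef (kernel_extend b) (val n) = coef b n.
Proof. by rewrite [LHS]/= /kernel_extend_fun valK. Qed.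

Lemma kernel_extend_nmod : nmod_morphism kernel_extend.
Proof.
split=> [|a b]; apply: seriesE => g.
  by rewrite /= /kernel_extend_fun; case: insub.
rewrite -[RHS]/(kernel_extend_fun a g + kernel_extend_fun b g) /=.
by rewrite /kernel_extend_fun; case: insub => [n|]; rewrite ?addr0.
Qed.

Lemma in_kernelM g h : in_kernel phi g -> in_kernel phi h -> in_kernel phi (g * h)%g.
Proof. by move=> /eqP g1 /eqP h1; rewrite /in_kernel gmulfM g1 h1 mulg1. Qed.

(* The coset (ker phi) h of G is identified with ker phi by n |-> n h. *)
Lemma kernel_extend_mul_coset b (a : RG) (n : N) (h : G) :
  (kernel_extend b * a) (val n * h)%g =
  \sum_(m \in [set: N]) coef b m * coef a (val (m^-1 * n)%g * h)%g.
Proof.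
rewrite series_mulE finsum_kernel.
- by apply: eq_fsbigr => m _; rewrite kernel_extend_val mulgA.
- exact: finite_term.
- move=> g; have [->|bg _] := eqVneq (coef (kernel_extend b) g) 0.
    by rewrite mul0r eqxx.
  exact: kernel_extend_neq0 bg.
Qed.

Lemma kernel_extend_monoid : monoid_morphism kernel_extend.
Proof.
split=> [|a b]; apply: seriesE => g.
  rewrite /= /kernel_extend_fun; case: insubP => [n _ <-|] /=.
    by rewrite -val_eqE.
  by case: eqP => // -> /negP[]; rewrite /in_kernel mult1.
rewrite [LHS]/= /kernel_extend_fun; case: insubP => [n _ <-|gN].
  rewrite -[val n]mulg1 kernel_extend_mul_coset; apply: eq_fsbigr => m _.
  by rewrite mulg1 kernel_extend_val.
apply/esym/eqP; apply: contraNT gN => /supp_convolution[x [y [ax bY ->]]].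
by apply: in_kernelM; [exact: kernel_extend_neq0 ax | exact: kernel_extend_neq0 bY].
Qed.

HB.instance Definition _ :=
  GRing.isNmodMorphism.Build RN RG kernel_extend kernel_extend_nmod.
HB.instance Definition _ :=
  GRing.isMonoidMorphism.Build RN RG kernel_extend kernel_extend_monoid.

Lemma augmentation_kernel_extend b :
  augmentation (kernel_extend b) = augmentation b.
Proof.
rewrite /augmentation finsum_kernel.
- by apply: eq_fsbigr => n _; rewrite kernel_extend_val.
- exact: group_ring_finite.
- exact: kernel_extend_neq0.
Qed.

Lemma kernel_extend_homogeneous b :
  fibre_component phi 1%g (kernel_extend b) = kernel_extend b.
Proof.
apply: seriesE => g; rewrite /= /fibre_fun /=; case: eqP => // g1.
by rewrite /kernel_extend_fun; case: insubP => // n /eqP.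
Qed.

Hypothesis phi_surj : forall q, exists g, phi g = q.

Definition section (q : Q) : G := projT1 (cid (phi_surj q)).

Lemma sectionK q : phi (section q) = q.
Proof. exact: projT2 (cid (phi_surj q)). Qed.

(** As a left [RN]-module, [RG] is free on the elements [section q]; this is the coordinate of [a]
    at [section q]. *)
Definition kernel_coord_fun (q : Q) (a : RG) (n : N) : R := coef a (val n * section q)%g.

Lemma kernel_coord_series q a :
  is_series (@finite_supports N) all_coefficients (kernel_coord_fun q a).
Proof.
apply/asboolP; split=> //; apply: finite_preimage (group_ring_finite a).
by move=> m n _ _ /mulIg; exact: val_inj.
Qed.

Definition kernel_coord q a : RN := Series (kernel_coord_series q a).

Lemma kernel_coord_scalar q b a a' :
  kernel_coord q (kernel_extend b * a + a') = b * kernel_coord q a + kernel_coord q a'.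
Proof.
apply: seriesE => n.
rewrite -[LHS]/((kernel_extend b * a) (val n * section q)%g + coef a' (val n * section q)%g).
by rewrite kernel_extend_mul_coset.
Qed.

Lemma mul_group_elt (a : RG) g h : (a * group_elt g) h = coef a (h / g)%g.
Proof.
rewrite series_mulE (@fsum1 _ _ _ (h / g)%g) /= /group_elt_fun.
  by rewrite invgF mulgVK eqxx mulr1.
move=> y yhg; case: eqP => [yh|_]; last by rewrite mulr0.
by rewrite -yh invgM invgK mulVKg eqxx in yhg.
Qed.

Lemma kernel_coordK q a :
  kernel_extend (kernel_coord q a) * group_elt (section q) = fibre_component phi q a.
Proof.
apply: seriesE => g; rewrite mul_group_elt /= /fibre_fun /kernel_extend_fun.
have gE : in_kernel phi (g / section q)%g = (phi g == q).
  by rewrite /in_kernel gmulfM multV sectionK divg_eq1.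
case: insubP => [n|]; rewrite gE => gq; last by rewrite (negPf gq).
by move=> nE; rewrite gq -[LHS]/(coef a (val n * section q)%g) nE mulgVK.
Qed.

Lemma kernel_coord_finite a : finite_set [set q | kernel_coord q a != 0].
Proof.
apply: sub_finite_set (fibre_component_finite phi a) => q /=.
rewrite -kernel_coordK; apply: contraNneq => e0.
(* Right multiplication by a group element is injective, so the coordinate vanishes with the
   component of degree [q]. *)
have : kernel_extend (kernel_coord q a) = 0.
  apply: seriesE => g; have := congr1 (fun f : RG => f (g * section q)%g) e0.
  by rewrite mul_group_elt mulgK.
move=> e1; apply/eqP/seriesE => n.
by rewrite -kernel_extend_val e1.
Qed.

Local Notation res_to_kernel P := (restrict_scalars kernel_extend P).

(** Each coordinate in [RG] is expanded in the [RN]-basis of elements [section q], so each [e t] is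
    replaced by its translates under them. *)
Lemma dual_basis_restrict (P : lmodType RG) (T : choiceType) (e : T -> P)
    (c : T -> P -> RG) : dual_basis e c ->
  dual_basis (fun t : Q * T => group_elt (section t.1) *: e t.2 : res_to_kernel P)
    (fun (t : Q * T) (x : res_to_kernel P) => kernel_coord t.1 (c t.2 x)).
Proof.
move=> [lin fin ex].
have fU x : finite_set (\bigcup_(t in [set t | c t x != 0])
    [set q | kernel_coord q (c t x) != 0]).
  by apply: bigcup_finite (fin x) _ => t _; exact: kernel_coord_finite.
have c0 x q t : kernel_coord q (c t x) != 0 -> c t x != 0.
  by apply: contraNneq => ->; apply/eqP/seriesE.
split=> [[q t] b x y|x|x] /=.
- by rewrite -kernel_coord_scalar -lin.
- apply: sub_finite_set (finite_setX (fU x) (fin x)) => -[q t] /= qt.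
  by split; [exists t => //; exact: c0 qt | exact: c0 qt].
have [ts uts tsP] := finite_cover (f := c^~ x) (fin x).
have [qs uqs qsE] := finite_uniq_seq (fU x).
have qsP q t : kernel_coord q (c t x) != 0 -> q \in qs.
  move=> qt; suff : [set` qs] q by [].
  by rewrite -qsE; exists t => //; exact: c0 qt.
(* All nonzero terms lie in the finite rectangle of pairs from [qs] and [ts], where the order of
   summation can be exchanged. *)
rewrite (@finsum_seq _ _ _ [seq (q, t) | q <- qs, t <- ts]); last 2 first.
- by apply: allpairs_uniq => // -[? ?] [? ?] _ _ [-> ->].
- move=> [q t] /= h; have qt : kernel_coord q (c t x) != 0.
    by apply: contraNneq h => ->; rewrite scale0r.
  by apply/allpairsP; exists (q, t); split=> //=; [exact: qsP qt | exact/tsP/c0/qt].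
rewrite big_allpairs_dep /= exchange_big /= {1}(ex x).
rewrite (@finsum_seq _ _ _ ts) //; last first.
  by move=> t h; apply: tsP; apply: contraNneq h => ->; rewrite scale0r.
apply: eq_bigr => t _.
rewrite -[in LHS](fibre_component_sum phi (c t x)) (finsum_seq uqs); last first.
  move=> q; rewrite -kernel_coordK => h; apply: (qsP _ t).
  by apply: contraNneq h => ->; rewrite rmorph0 mul0r.
rewrite scaler_suml; apply: eq_bigr => q _.
by rewrite -kernel_coordK -scalerA.
Qed.

Lemma projective_restrict (P : lmodType RG) :
  projective P -> projective (res_to_kernel P).
Proof.
by move=> /projective_dual_basis[c /dual_basis_restrict]; exact: dual_basis_projective.
Qed.

Definition restrict_map (U V : lmodType RG) (f : {linear U -> V}) :
  res_to_kernel U -> res_to_kernel V := f.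

Lemma restrict_map_linear U V f : linear (@restrict_map U V f).
Proof. by move=> b x y; exact: (linearP f). Qed.

HB.instance Definition _ U V f :=
  GRing.isLinear.Build RN _ _ _ (@restrict_map U V f) (restrict_map_linear f).

Variable P : projective_resolution (trivial_module R G).

Definition restrict_aug : res_to_kernel (res P 0) -> trivial_module R N := res_aug P.

Lemma restrict_aug_linear : linear restrict_aug.
Proof.
move=> b x y; rewrite /restrict_aug; have := linearP (res_aug P) (kernel_extend b) x y.
by rewrite -[X in _ = X + _]/(augmentation (kernel_extend b) * _) augmentation_kernel_extend.
Qed.

HB.instance Definition _ :=
  GRing.isLinear.Build RN _ _ _ restrict_aug restrict_aug_linear.

(** Restriction keeps the underlying groups and maps, so exactness is that of [P]; projectivity
    comes from [projective_restrict]. *)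
Definition restrict_resolution : projective_resolution (trivial_module R N) :=
  @ProjectiveResolution RN (trivial_module R N) (fun i => res_to_kernel (res P i))
    (fun i => restrict_map (res_d P i)) restrict_aug
    (fun i => projective_restrict (@res_projective _ _ P i))
    (@res_aug_surj _ _ P) (@res_exact0 _ _ P) (@res_exact _ _ P).

End KernelRing.

(** * Sign classes and finiteness of Novikov supports *)

Section NovikovFiniteness.
Local Open Scope classical_set_scope.
Context {K : realType} {Q : groupType} {n : nat}.
Variable chi : multicharacter K Q n.
Local Notation Q_ := (cterm (mseries chi)).

(** The choice is made from the coset as a set, hence is the same for all elements of one coset. *)
Definition coset_rep (i : nat) (q : Q) : Q := xget 1%g (right_coset (Q_ i) q).

Lemma coset_repP i q : (i <= n)%N -> Q_ i (coset_rep i q / q)%g.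
Proof.
move=> lein; suff : right_coset (Q_ i) q (coset_rep i q) by [].
by apply: (xgetPex 1%g); exists q; exact: coset_refl.
Qed.

Lemma coset_rep_eq i p q : (i <= n)%N -> Q_ i (p / q)%g ->
  coset_rep i p = coset_rep i q.
Proof. by move=> lein pq; rewrite /coset_rep (coset_eq lein pq). Qed.

(* At each level i, only the finitely many cosets where chi_i <= 0 are left. *)
Lemma novikov_support_finite m i q (A : set Q) : (i + m = n)%N ->
  novikov_support chi m i q A ->
  (forall j p, (i <= j < n)%N -> A p -> mchar chi j (p / coset_rep j p)%g <= 0) ->
  finite_set A.
Proof.
elim: m i q A => [|m IH] i q A imn SA A0.
  exact: sub_finite_set SA (finite_set1 q).
have ltin : (i < n)%N by rewrite -imn addnS ltnS leq_addr.
have [Aq _ _] := SA.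
(* Recentring at [coset_rep i q] makes the level-[i] values of the character those bounded by [A0],
   so that [A3] can be used with bound 0. *)
have [A1 A2 A3] := novikov_support_shift imn (coset_repP q (ltnW ltin)) SA.
have [s [sA sP]] := (coset_repsP chi _ ltin).1 (A3 0).
have sub : A `<=` \bigcup_(p in [set` s]) (A `&` right_coset (Q_ i.+1) p).
  move=> p Ap; have [|p' p's pp'] := sP p.
    split=> //; rewrite -(coset_rep_eq (ltnW ltin) (Aq _ Ap)).
    by apply: A0 => //; rewrite leqnn.
  by exists p'.
apply: (sub_finite_set sub); apply: bigcup_finite => [|p ps].
  exact: finite_seq.
have [Ap _] := sA p ps.
apply: (IH i.+1 p); first by rewrite addSnnS.
  exact: A2 (A1 _ Ap).
by move=> j p' /andP[ij jn] [Ap' _]; apply: A0; rewrite // jn ltnW.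
Qed.

(** The bit is [true] at positive values, and [true] means a minus sign in [signed_multicharacter].
    With the signs of its own pattern, [q] thus has value at most 0 at every level. *)
Definition sign_pattern (q : Q) : n.-tuple bool :=
  [tuple 0 < mchar chi i (q / coset_rep i q)%g | i < n].

End NovikovFiniteness.

Lemma finite_sign_class (K : realType) (Q : groupType) (n : nat)
    (chi : multicharacter K Q n) (eps : n.-tuple bool) (A : set Q) :
  novikov_supports (signed_multicharacter eps chi) A ->
  finite_set (A `&` [set q | sign_pattern chi q = eps])%classic.
Proof.
move=> SA; apply: (novikov_support_finite (add0n n)).
  by apply: novikov_support_sub SA; exact: subIsetl.
move=> j p /andP[_ jn] [_ /= pe].
(* Changing signs keeps the central series, hence also the representatives. *)
rewrite -[coset_rep _ _ _]/(coset_rep chi j p) /= /signed_char -pe.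
rewrite -[j]/(val (Ordinal jn)) -tnth_nth tnth_mktuple /=.
by case: ltP => p0; rewrite ?expr1 ?mulN1r ?oppr_le0 ?mul1r // ltW.
Qed.

(** * Extending maps along a differential, linearly over the kernel *)

Section NovikovExtension.
Local Open Scope classical_set_scope.
Context {K : realType} {R : nzRingType} {G Q : groupType}.
Variables (phi : {multiplicative G -> Q}) (phi_surj : forall q, exists g, phi g = q).
Context {n : nat}.
Variable chi : multicharacter K Q n.
Local Notation RG := (group_ring R G).
Local Notation RN := (group_ring R (kernel phi)).
Local Notation res_to_kernel P := (restrict_scalars (@kernel_extend R G Q phi) P).

(** An element of [RN] is homogeneous of degree 1, so a single term of the convolution survives.
    This makes extraction of the degree [q] term linear over [RN]. *)
Lemma novikov_coef_scalar (psi : multicharacter K Q n)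
    (a b : novikov_module R phi_surj psi) (c : RN) q :
  coef (kernel_extend c *: a + b) q = kernel_extend c * coef a q + coef b q.
Proof.
rewrite -[LHS]/(\sum_(p \in [set: Q]) fibre_component phi p (kernel_extend c) *
  coef a (p^-1 * q)%g + coef b q).
rewrite (@fsum1 _ _ _ 1%g) ?invg1 ?mul1g ?kernel_extend_homogeneous // => p p1.
by rewrite -kernel_extend_homogeneous fibre_componentK (negPf p1) mul0r.
Qed.

Variables (X Y : lmodType RG) (D : {linear X -> Y}).
Variables (k : nat) (e : 'I_k -> X) (c : 'I_k -> X -> RG).
Hypothesis c_dual : forall x, x = \sum_i c i x *: e i.
Hypothesis extend_novikov : forall (eps : n.-tuple bool) i,
  exists g : {linear Y -> novikov_module R phi_surj (signed_multicharacter eps chi)},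
    forall x q, coef (g (D x)) q = fibre_component phi q (c i x).

Lemma extend_over_kernel (M : lmodType RN) (f : {linear res_to_kernel X -> M}) :
  exists h : {linear res_to_kernel Y -> M}, forall x, f x = h (D x).
Proof.
pose nov eps := novikov_module R phi_surj (signed_multicharacter eps chi).
have [g gE] : exists g : forall eps, 'I_k -> {linear Y -> nov eps},
    forall eps i x q, coef (g eps i (D x)) q = fibre_component phi q (c i x).
  exists (fun eps i => projT1 (cid (extend_novikov eps i))) => eps i.
  exact: projT2 (cid (extend_novikov eps i)).
have fZ b (x : X) : f (kernel_extend b *: x) = b *: f x by exact: (linearZ_LR f b x).
(* The degree [q] term is read off the extension attached to the signs of [q] itself. *)
pose coeff q (i : 'I_k) (y : Y) : RG := coef (g (sign_pattern chi q) i y) q.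
pose l q (y : res_to_kernel Y) : M := \sum_i f (coeff q i y *: e i).
have llin q : linear (l q).
  move=> b x y; rewrite /l scaler_sumr -big_split; apply: eq_bigr => i _ /=.
  rewrite /coeff linearP novikov_coef_scalar scalerDl linearD -scalerA.
  by rewrite fZ.
have lfin y : finite_set [set q | l q y != 0].
  (* There are finitely many pairs of a sign vector and an index, and each contributes a support cut
     down to its sign class, which is finite. *)
  pose F (t : n.-tuple bool * 'I_k) :=
    supp (coef (g t.1 t.2 y)) `&` [set q | sign_pattern chi q = t.1].
  apply: (sub_finite_set (B := \bigcup_(t in [set: n.-tuple bool * 'I_k]) F t)).
    move=> q /= lq; apply: contrapT => qF; case/eqP: lq; apply: big1 => i _.
    suff -> : coeff q i y = 0 by rewrite scale0r linear0.
    apply: contrapT => /eqP cq; apply: qF; exists (sign_pattern chi q, i) => //.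
  apply: bigcup_finite => [|t _]; first exact: finite_finset.
  by apply: finite_sign_class; have [] := seriesP (g t.1 t.2 y).
have [h hE] := linear_exists (linear_finsum llin lfin).
exists h => x; rewrite hE.
have : finite_set (\bigcup_(i in [set: 'I_k]) [set q | fibre_component phi q (c i x) != 0]).
  apply: bigcup_finite => [|i _]; first exact: finite_finset.
  exact: fibre_component_finite.
move=> /finite_uniq_seq[s us sE].
have sP q i : fibre_component phi q (c i x) != 0 -> q \in s.
  by move=> qi; suff : [set` s] q by []; rewrite -sE; exists i.
(* On the image of [D] the choice of signs disappears: all extensions have there the components of
   [c i x] as terms. *)
have lE q : l q (D x) = \sum_i f (fibre_component phi q (c i x) *: e i).
  by apply: eq_bigr => i _; rewrite /coeff gE.
rewrite (finsum_seq us) => [|q]; last first.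
  apply: contra_neqT => qs; rewrite lE; apply: big1 => i _.
  suff -> : fibre_component phi q (c i x) = 0 by rewrite scale0r linear0.
  by apply: contraNeq qs; exact: sP.
under eq_bigr do rewrite lE.
rewrite exchange_big /= {1}(c_dual x) linear_sum; apply: eq_bigr => i _.
rewrite -linear_sum; congr (f _).
rewrite -[c i x in LHS](fibre_component_sum phi) (finsum_seq us (sP^~ i)).
by rewrite scaler_suml.
Qed.

End NovikovExtension.

(** * Vanishing for the kernel and the bound on its dimension *)

(** The inequality stays strict under the supremum because degrees are integers: for positive [d]
    they are bounded by [d - 1], and for [d = 0] the set is empty, with supremum minus infinity. *)
Lemma cd_lt (K : realType) (R : nzRingType) (G : groupType) (d : nat) :
  (forall m (M : lmodType (group_ring R G)), (d <= m)%N -> cohomology_eq0 m M) ->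
  (cd K R G < (d%:R)%:E)%E.
Proof.
move=> van; rewrite /cd; case: d => [|d] in van *.
  rewrite (_ : image _ _ = set0) ?ereal_sup0 ?ltNyr //.
  by apply/seteqP; split=> // _ [m [M []]]; exact: van.
apply: (@le_lt_trans _ _ d%:R%:E%E); last by rewrite lte_fin ltr_nat.
apply: ge_ereal_sup => _ [m [M HM] <-]; rewrite lee_fin ler_nat -ltnS ltnNge.
by apply/negP => dm; apply: HM; exact: van.
Qed.

Lemma kernel_coboundary (K : realType) (R : nzRingType) (G Q : groupType)
    (phi : {multiplicative G -> Q}) (phi_surj : forall q, exists g, phi g = q)
    (d n : nat) (chi : multicharacter K Q n)
    (P : projective_resolution (trivial_module R G)) :
  (forall x : res P d.+1, x = 0) -> finitely_generated (res P d) ->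
  (forall eps : n.-tuple bool,
     cohomology_eq0 d (novikov_module R phi_surj (signed_multicharacter eps chi))) ->
  forall (M : lmodType (group_ring R (kernel phi)))
    (f : {linear res (restrict_resolution phi_surj P) d -> M}), coboundary f.
Proof.
move=> Pd0 fg vanish M f.
have [k [e [c [clin cE]]]] := finitely_generated_dual_basis (@res_projective _ _ P d) fg.
have nov eps i : exists2 g : {linear res P d ->
      novikov_module R phi_surj (signed_multicharacter eps chi)},
    forall x q, coef (g x) q = fibre_component phi q (c i x) & coboundary g.
  have lin : linear (fun x : res P d =>
      novikov_inclusion (signed_multicharacter eps chi)
        (group_ring_crossed_product phi_surj) (c i x) :
      novikov_module R phi_surj (signed_multicharacter eps chi)).
    by move=> a x y; rewrite clin rmorphD rmorphM.
  have [g gE] := linear_exists lin; exists g => [x q|]; first by rewrite gE.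
  (* As the module in degree [d + 1] is zero, every cochain of degree [d] is a cocycle. *)
  by apply: vanish => y; rewrite (Pd0 y) !linear0.
(* For positive degree, the coboundary condition supplies the extensions along the differential. *)
case: d => [|d] in Pd0 fg vanish M f k e c clin cE nov *; last first.
  apply: (extend_over_kernel (D := res_d P d) cE) => eps i.
  by have [g gE [h hE]] := nov eps i; exists h => x q; rewrite -hE.
(* In degree 0 a coboundary is zero, so the coordinates vanish in a completion, hence in [RG], and
   the whole module is zero. Any choice of signs will do; all plus is taken. *)
move=> x; suff -> : x = 0 by rewrite linear0.
rewrite (cE x) big1 // => i _.
have [g gE g0] := nov [tuple false | _ < n] i.
suff -> : c i x = 0 by rewrite scale0r.
rewrite -[c i x](fibre_component_sum phi); apply: fsbig1 => q _.
by rewrite -gE g0.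
Qed.

Theorem theorem6p6 (K : realType) (R : nzRingType) (G Q : groupType)
    (phi : {multiplicative G -> Q}) (phi_surj : forall q, exists g, phi g = q)
    (nilQ : nilpotent_group Q) (d : nat) (FTPG : type_FTP d R G)
    (n : nat) (chi : multicharacter K Q n)
    (vanish : forall eps : n.-tuple bool,
       cohomology_eq0 d (novikov_module R phi_surj (signed_multicharacter eps chi))) :
  (cd K R (kernel phi) < (d%:R)%:E)%E.
Proof.
have [P [P0 fg]] := FTPG.
have van m (M : lmodType (group_ring R (kernel phi))) :
    (d <= m)%N -> cohomology_eq0 m M.
  rewrite leq_eqVlt => /predU1P[<-|dm];
    apply: (Ext_eq0_resolution (P := restrict_resolution phi_surj P)) => f _.
    by apply: kernel_coboundary fg vanish _ f => x; exact: P0.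
  (* Above degree [d] the resolution itself is zero. *)
  have f0 x : f x = 0 by rewrite [x](P0 m dm) linear0.
  case: m => [|m] in dm f f0 *; first by [].
  by exists \0 => x; rewrite f0.
exact: cd_lt van.
Qed.
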